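(* Fix $d\ge2$ and let $\mathcal X=\{\mathcal X_n\}$ be a (discrete) prior on the unit sphere in $\mathbb R^n$ with bounded Rényi entropy density: there exists $\delta>0$ with $$\limsup_{n\to\infty}\frac1nH_{1-\delta}(\mathcal X_n)<\infty.$$ Suppose furthermore that the varentropy $V(\mathcal X_n)=\operatorname{Var}_{x\sim\mathcal X_n}[-\log\Pr_{\mathcal X_n}(x)]$ is $o(n^2)$. Let $s=\limsup_{n\to\infty}\frac1nH_1(\mathcal X_n)$ be the Shannon entropy density. Then when $\lambda>2\sqrt s$, there exists a hypothesis test distinguishing $\mathrm{WT}(d,\lambda,\mathcal X)$ from $\mathrm{WT}(d)$ with probability $o(1)$ of error as $n\to\infty$ (i.e. strong detection is possible), and furthermore there exists an estimator that achieves nontrivial correlation with the spike (i.e. weak recovery is possible).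
   Context: Wigner tensor: for integers $d\ge2$, $n\ge1$, $\mathrm{WT}(d)=\mathrm{WT}_n(d)$ is the law of the symmetric tensor $W\in(\mathbb R^n)^{\otimes d}$ obtained by drawing $W'\in\mathbb R^{n^d}$ with i.i.d. $\mathcal N(0,2/n)$ entries and averaging it over all $d!$ permutations of the indices. Spiked model: a prior $\mathcal X=\{\mathcal X_n\}$ is a family of distributions on unit vectors of $\mathbb R^n$; for $\lambda\ge0$ not depending on $n$, $\mathrm{WT}(d,\lambda,\mathcal X)$ is the law of $T=\lambda x^{\otimes d}+W$ with $x\sim\mathcal X_n$ and $W\sim\mathrm{WT}_n(d)$ independent. Entropies: for a discrete random variable taking values $x_i$ with probabilities $p_i$, the Rényi entropy of order $\alpha\ge0$, $\alpha\ne1$, is $H_\alpha=\frac{1}{1-\alpha}\log\left(\sum_ip_i^\alpha\right)$, and $H_1=-\sum_ip_i\log p_i$ is the Shannon entropy. $\Pr_{\mathcal X_n}(x)$ is the probability mass of $x$ under $\mathcal X_n$. Strong detection: given a single sample from either $\mathrm{WT}(d,\lambda,\mathcal X)$ or $\mathrm{WT}(d)$, each chosen with probability $1/2$, decide which one with success probability $1-o(1)$ as $n\to\infty$. Weak recovery: given a sample $T$ from $\mathrm{WT}(d,\lambda,\mathcal X)$, output a unit vector $\hat x=\hat x(T)$ with $\mathbb E[\langle x,\hat x\rangle^d]\ge\varepsilon$ as $n\to\infty$, for some $\varepsilon>0$ not depending on $n$. There is no computational restriction. *)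

(* Defs.v *)
From HB Require Import structures.
From mathcomp Require Import all_boot all_order all_algebra perm.
From mathcomp Require Import all_classical all_reals all_analysis.

Set Implicit Arguments.
Unset Strict Implicit.
Unset Printing Implicit Defensive.

Import Order.TTheory GRing.Theory Num.Theory.
Import numFieldNormedType.Exports.

Local Open Scope classical_set_scope.
Local Open Scope ring_scope.

(* Finite families over I carry the product sigma-algebra, generated by the
   coordinate evaluations. *)
Definition measure_ffun_display : measure_display -> measure_display.
Proof. exact. Qed.

Section measurable_ffun.
Context {d} {T : measurableType d} {I : finType}.

HB.instance Definition _ := isPointed.Build {ffun I -> T} [ffun=> point].

Definition ffun_cylinders : set (set {ffun I -> T}) :=
  \bigcup_(i in [set: I])
    preimage_set_system setT (fun x : {ffun I -> T} => x i) measurable.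

HB.instance Definition _ := @isMeasurable.Build (measure_ffun_display d)
  {ffun I -> T} <<s ffun_cylinders >>
  (@sigma_algebra0 _ setT ffun_cylinders) (@sigma_algebraC _ ffun_cylinders)
  (@sigma_algebra_bigcup _ setT ffun_cylinders).

Lemma measurable_ffun_eval (i : I) :
  measurable_fun [set: {ffun I -> T}] (fun x => x i).
Proof.
move=> _ A mA; apply: sub_sigma_algebra.
by exists i => //; exists A.
Qed.

Lemma measurable_fun_ffunP d' (S : measurableType d') (f : S -> {ffun I -> T}) :
  (forall i, measurable_fun [set: S] (fun s => f s i)) ->
  measurable_fun [set: S] f.
Proof.
move=> mf; apply: (@measurability _ _ _ _ _ _ ffun_cylinders) => //.
move=> _ [_ [i _ [A mA <-]] <-].
rewrite [X in measurable X](_ : _ = setT `&` (fun s => f s i) @^-1` A).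
  exact: mf.
by apply/seteqP; split => s /=; rewrite ?setTI //= => -[].
Qed.

End measurable_ffun.

Section iid.
Context d (T : measurableType d) (R : realType) (P : probability T R).

Definition tuple_cons n (p : T * n.-tuple T) : n.+1.-tuple T :=
  [tuple of p.1 :: p.2].

Lemma measurable_tuple_cons n : measurable_fun setT (@tuple_cons n).
Proof. exact: measurable_cons. Qed.

HB.instance Definition _ n :=
  isMeasurableFun.Build _ _ _ _ (@tuple_cons n) (@measurable_tuple_cons n).

Fixpoint iid_tuple n : probability (n.-tuple T) R :=
  match n with
  | 0 => dirac [tuple]
  | m.+1 => distribution (P \x iid_tuple m)%E (@tuple_cons m)
  end.

Variable I : finType.

Definition ffun_of_tuple (t : #|I|.-tuple T) : {ffun I -> T} :=
  [ffun i => tnth t (enum_rank i)].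

Lemma measurable_ffun_of_tuple : measurable_fun setT ffun_of_tuple.
Proof.
apply: measurable_fun_ffunP => i.
under eq_fun do rewrite ffunE.
exact: measurable_tnth.
Qed.

HB.instance Definition _ :=
  isMeasurableFun.Build _ _ _ _ ffun_of_tuple measurable_ffun_of_tuple.

Definition iid : probability {ffun I -> T} R :=
  distribution (iid_tuple #|I|) ffun_of_tuple.

Lemma iid_tuple_box n (A : 'I_n -> set T) : (forall i, measurable (A i)) ->
  iid_tuple n [set t | forall i, A i (tnth t i)] = (\prod_(i < n) P (A i))%E.
Proof.
elim: n A => [|n IHn] A mA /=.
  rewrite big_ord0 diracE mem_set//= => -[]//.
rewrite big_ord_recl -IHn; last by move=> i; exact: mA.
rewrite -product_measure1E//; last first.
  rewrite [X in measurable X](_ : _ =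
      \bigcap_(i in [set: 'I_n]) ((fun t => tnth t i) @^-1` A (lift ord0 i))).
    apply: fin_bigcap_measurable => // i _.
    by rewrite -[X in measurable X]setTI; apply: measurable_tnth.
  by apply/seteqP; split=> t /= At i; [move=> _|]; apply: At.
rewrite /distribution /pushforward /=; congr (product_measure1 _ _ _).
apply/seteqP; split=> -[x t] /=.
  by move=> Axt; split=> [|i]; [have := Axt ord0|have := Axt (lift ord0 i)];
    rewrite ?tnth0 ?tnthS.
move=> [Ax At] i; have [j ->|->] := unliftP ord0 i.
  by rewrite tnthS.
by rewrite tnth0.
Qed.

Lemma iid_box (A : I -> set T) : (forall i, measurable (A i)) ->
  iid [set x | forall i, A i (x i)] = (\prod_i P (A i))%E.
Proof.
move=> mA; rewrite (reindex (@enum_val I predT)) /=; last first.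
  by apply: onW_bij; exact: enum_val_bij.
rewrite -(@iid_tuple_box _ (fun k => A (enum_val k)))//.
rewrite /iid /distribution /pushforward; congr (iid_tuple _ _).
apply/seteqP; split=> t /= At i.
  by have := At (enum_val i); rewrite ffunE enum_valK.
by rewrite ffunE; have := At (enum_rank i); rewrite enum_rankK.
Qed.

End iid.

Section spiked_tensor.
Context {R : realType}.

Definition vec n := {ffun 'I_n -> R}.
(* (R^n)^{\otimes d}: entries indexed by multi-indices 'I_d -> 'I_n *)
Definition tensor n d := {ffun {ffun 'I_d -> 'I_n} -> R}.

Definition inner n (x y : vec n) : R := \sum_i x i * y i.

Definition unit_vector n (x : vec n) : Prop := inner x x = 1.

Definition tensor_power n d (x : vec n) : tensor n d :=
  [ffun i : {ffun 'I_d -> 'I_n} => \prod_(k < d) x (i k)].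

Definition symmetrize n d (W : tensor n d) : tensor n d :=
  [ffun i : {ffun 'I_d -> 'I_n} =>
    (d`!%:R)^-1 * \sum_(s : 'S_d) W [ffun k => i (s k)]].

Lemma measurable_symmetrize n d : measurable_fun setT (@symmetrize n d).
Proof.
apply: measurable_fun_ffunP => i.
under eq_fun do rewrite ffunE.
apply: measurable_realfun.measurable_funM => //; apply: measurable_sum => s.
exact: measurable_ffun_eval.
Qed.

HB.instance Definition _ n d := isMeasurableFun.Build _ _ _ _
  (@symmetrize n d) (@measurable_symmetrize n d).

(* normal_prob lives on the sigma-algebra generated by the half-open intervals,
   whose canonical display differs from that of R: push it forward by the
   identity. *)
Definition idTR : measurableTypeR R -> R := idfun.

HB.instance Definition _ :=
  @isMeasurableFun.Build _ _ _ _ idTR (@measurable_id _ _ setT).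

(* N(0, v): normal_prob takes the standard deviation. *)
Definition centered_normal (v : R) : probability R R :=
  distribution (normal_prob 0 (Num.sqrt v)) idTR.

Definition WT n d : probability (tensor n d) R :=
  distribution (iid (centered_normal (2 / n%:R)) {ffun 'I_d -> 'I_n})
    (@symmetrize n d).

Definition add_spike n d (lambda : R) (p : vec n * tensor n d) : tensor n d :=
  [ffun i => lambda * tensor_power d p.1 i + p.2 i].

Lemma measurable_add_spike n d lambda :
  measurable_fun setT (@add_spike n d lambda).
Proof.
apply: measurable_fun_ffunP => i.
under eq_fun do rewrite !ffunE.
apply: measurable_realfun.measurable_funD; last first.
  exact: (measurableT_comp (measurable_ffun_eval i) measurable_snd).
apply: measurable_realfun.measurable_funM => //; apply: measurable_prod => k _.
exact: (measurableT_comp (measurable_ffun_eval _) measurable_fst).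
Qed.

HB.instance Definition _ n d lambda := isMeasurableFun.Build _ _ _ _
  (@add_spike n d lambda) (@measurable_add_spike n d lambda).

Definition prior_family := forall n, probability (vec n) R.

(* There is no unit vector in dimension 0: the component X 0 of a family is
   never constrained. *)
Definition spherical_prior (X : prior_family) : Prop :=
  forall n, (0 < n)%N -> X n [set x | unit_vector x] = 1%E.

Definition discrete_prior (X : prior_family) : Prop :=
  forall n, (0 < n)%N -> exists2 S : set (vec n), countable S & X n S = 1%E.

(* Joint law of the independent pair (x, W). *)
Definition spike_noise d (X : prior_family) n :
  probability (vec n * tensor n d)%type R := (X n \x WT n d)%E.

Definition spiked_WT d lambda (X : prior_family) n :
  probability (tensor n d) R :=
  distribution (spike_noise d X n) (@add_spike n d lambda).

Definition mass n (P : probability (vec n) R) (x : vec n) : R :=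
  fine (P [set x]).

Definition atoms n (P : probability (vec n) R) : set (vec n) :=
  [set x | 0 < mass P x].

(* Natural logarithms; the sums range over the atoms, so that the order-0
   entropy counts the support. The values may be +oo. *)
Definition renyi_entropy n (alpha : R) (P : probability (vec n) R) : \bar R :=
  if alpha == 1 then
    \esum_(x in atoms P) (- (mass P x * ln (mass P x)))%:E
  else
    ((1 - alpha)^-1%:E * lne (\esum_(x in atoms P) (mass P x `^ alpha)%:E))%E.

Definition entropy_density (alpha : R) (X : prior_family) : \bar R :=
  limn_esup (fun n => (n%:R^-1%:E * renyi_entropy alpha (X n))%E).

Definition surprisal n (P : probability (vec n) R) (x : vec n) : R :=
  - ln (mass P x).

Definition varentropy n (P : probability (vec n) R) : \bar R :=
  ('V_P[surprisal P])%E.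

(* A test answers true for the spiked model. *)
Definition success_probability d lambda (X : prior_family) n
    (test : tensor n d -> bool) : \bar R :=
  (2^-1%:E * spiked_WT d lambda X n [set T | test T = true] +
   2^-1%:E * WT n d [set T | test T = false])%E.

Definition strong_detection d lambda (X : prior_family) : Prop :=
  exists test : forall n, {mfun tensor n d >-> bool},
    (fun n => success_probability lambda X (test n)) @ \oo --> 1%E.

Definition overlap n d lambda (xhat : tensor n d -> vec n)
    (p : vec n * tensor n d) : R :=
  inner p.1 (xhat (add_spike lambda p)) ^+ d.

Definition weak_recovery d lambda (X : prior_family) : Prop :=
  exists (xhat : forall n, {mfun tensor n d >-> vec n}) (eps : R),
    [/\ 0 < eps,
        forall n T, (0 < n)%N -> unit_vector (xhat n T) &
        \forall n \near \oo,
          (eps%:E <= 'E_(spike_noise d X n)[overlap lambda (xhat n)])%E].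

End spiked_tensor.

Arguments prior_family : clear implicits.

(* Main.v *)
(** Averaging over index permutations does not change the pairing with
    [x^{⊗d}], so [<x^{⊗d}, W> = <x^{⊗d}, W'>] is [N(0, 2/n)] for unit [x].
    Fix [t' < t < lambda] and [eta > 0] with [s + eta < t'^2 / 4]. By Chebyshev
    and the varentropy hypothesis, the spike has mass at least [e^{-n(s + eta)}]
    with probability [1 - o(1)], and at most [e^{n(s + eta)}] vectors are that
    heavy. A union bound over these heavy atoms [y] shows that, with probability
    [1 - o(1)], all of them satisfy [<y^{⊗d}, W> < t'], whereas the true spike
    satisfies [<x^{⊗d}, T> >= t]. The test asks whether some heavy atom [y] has
    [<y^{⊗d}, T> >= t], and the estimator returns such a [y]: then
    [lambda <x, y>^d >= t - t']. *)
From HB Require Import structures.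
Require Import Defs.
From mathcomp Require Import all_boot all_order all_algebra perm finmap.
From mathcomp Require Import all_classical all_reals all_analysis.
From mathcomp Require Import measurable_realfun.
From mathcomp Require Import ring lra.

Set Implicit Arguments.
Unset Strict Implicit.

Import Order.TTheory GRing.Theory Num.Theory.
Import numFieldNormedType.Exports.

Local Open Scope classical_set_scope.
Local Open Scope ring_scope.

(** * Exponential moments of normal laws *)

Section gaussian_chernoff.
Context {R : realType}.

(** The Radon-Nikodym derivative and [normal_pdf] have the same integral over every measurable set,
    hence agree almost everywhere and may be exchanged under the integral. *)
Lemma ge0_integral_normal_prob (m s : R) (f : measurableTypeR R -> \bar R) :
  measurable_fun [set: measurableTypeR R] f -> (forall x, 0 <= f x)%E ->
  (\int[normal_prob m s]_x f x =
   \int[lebesgue_measure]_x (f x * (normal_pdf m s x)%:E))%E.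
Proof.
move=> mf f0; have dom := normal_prob_dominates m s.
have mpdf : measurable_fun [set: measurableTypeR R]
    (fun x : measurableTypeR R => (normal_pdf m s x)%:E).
  apply/measurable_EFinP; exact: measurable_normal_pdf.
have irn := Radon_Nikodym_SigmaFinite.f_integrable dom.
rewrite -(Radon_Nikodym_SigmaFinite.change_of_variables dom)//.
apply: ae_eq_integral => //.
- by apply: emeasurable_funM => //; exact: measurable_int irn.
- exact: emeasurable_funM.
- apply: ae_eqe_mul2l; apply: integral_ae_eq => // E _ mE.
  by rewrite -Radon_Nikodym_SigmaFinite.f_integral.
Qed.

Lemma normal_mgf (s a : R) : s != 0 ->
  (\int[normal_prob 0 s]_x (expR (a * x))%:E =
   (expR (a ^+ 2 * s ^+ 2 / 2))%:E)%E.
Proof.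
move=> s0.
have mexp : measurable_fun [set: measurableTypeR R]
    (fun x : measurableTypeR R => (expR (a * x))%:E).
  by apply/measurable_EFinP; apply: measurableT_comp => //;
    apply: measurable_funM.
rewrite ge0_integral_normal_prob//.
(* Completing the square recentres the density at [a s^2]. *)
transitivity (\int[lebesgue_measure]_x ((expR (a ^+ 2 * s ^+ 2 / 2))%:E *
    (normal_pdf (a * s ^+ 2) s x)%:E))%E.
  apply: eq_integral => x _; rewrite -!EFinM !normal_pdfE// /normal_fun mulrCA.
  by rewrite [in RHS]mulrCA -!expRD; congr (_ * expR _)%:E; field.
rewrite ge0_integralZl_EFin//.
- by rewrite integral_normal_pdf mule1.
- by move=> x _; rewrite lee_fin normal_pdf_ge0.
- by apply/measurable_EFinP; exact: measurable_normal_pdf.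
Qed.

Lemma centered_normal_mgf (v a : R) : 0 < v ->
  (\int[centered_normal v]_x (expR (a * x))%:E =
   (expR (a ^+ 2 * v / 2))%:E)%E.
Proof.
move=> v0; rewrite ge0_integral_distribution//=.
- by rewrite normal_mgf ?sqr_sqrtr// ?(ltW v0)// gt_eqF// sqrtr_gt0.
- by apply/measurable_EFinP; apply: measurableT_comp => //;
    apply: measurable_funM.
Qed.

End gaussian_chernoff.

(** * Independence: product functions under i.i.d. laws *)

Section iid_product.
Context d (T : measurableType d) (R : realType) (P : probability T R).

(** By induction on [n]: Tonelli splits off the first coordinate, and nonnegativity stands in for
    integrability. *)
Lemma integral_iid_tuple_prod n (f : 'I_n -> T -> R) :
  (forall i, measurable_fun setT (f i)) -> (forall i x, 0 <= f i x) ->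
  (\int[iid_tuple P n]_t (\prod_(i < n) f i (tnth t i))%:E =
   \prod_(i < n) \int[P]_x (f i x)%:E)%E.
Proof.
have mprod m (g : 'I_m -> T -> R) : (forall i, measurable_fun setT (g i)) ->
    measurable_fun setT (fun t : m.-tuple T => \prod_(i < m) g i (tnth t i)).
  move=> mg; apply: measurable_prod => i _.
  exact: measurableT_comp (mg i) (measurable_tnth i).
elim: n f => [|n IHn] f mf f0 /=.
  rewrite integral_dirac//=; last by apply/measurable_EFinP; exact: mprod.
  by rewrite diracE in_setT mul1e !big_ord0.
rewrite ge0_integral_distribution//=;
  [|by apply/measurable_EFinP; exact: mprod|]; last first.
  by move=> y; rewrite lee_fin prodr_ge0.
have E (z : T * n.-tuple T) : \prod_(i < n.+1) f i (tnth (tuple_cons z) i) =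
    f ord0 z.1 * \prod_(i < n) f (lift ord0 i) (tnth z.2 i).
  rewrite big_ord_recl tnth0; congr (_ * _).
  by apply: eq_bigr => i _; rewrite tnthS.
under eq_integral do rewrite /= E.
have mtail : measurable_fun setT
    (fun t : n.-tuple T => \prod_(i < n) f (lift ord0 i) (tnth t i)).
  by apply: (mprod n (fun i => f (lift ord0 i))).
have tail0 t : 0 <= \prod_(i < n) f (lift ord0 i) (tnth t i).
  exact: prodr_ge0.
rewrite fubini_tonelli1/=; last 2 first.
- apply/measurable_EFinP; apply: measurable_realfun.measurable_funM.
    exact: measurableT_comp (mf ord0) measurable_fst.
  exact: measurableT_comp mtail measurable_snd.
- by move=> z; rewrite lee_fin mulr_ge0.
rewrite /fubini_F big_ord_recl -IHn//.
transitivity (\int[P]_x ((f ord0 x)%:E * \int[iid_tuple P n]_t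
    (\prod_(i < n) f (lift ord0 i) (tnth t i))%:E))%E.
  apply: eq_integral => x _.
  under eq_integral do rewrite /= EFinM.
  rewrite ge0_integralZl_EFin//.
  - by move=> t _; rewrite lee_fin.
  - exact/measurable_EFinP.
rewrite ge0_integralZr//.
- exact/measurable_EFinP.
- by move=> x _; rewrite lee_fin.
- by apply: integral_ge0 => t _; rewrite lee_fin.
Qed.

Lemma integral_iid_prod (I : finType) (f : I -> T -> R) :
  (forall i, measurable_fun setT (f i)) -> (forall i x, 0 <= f i x) ->
  (\int[iid P I]_w (\prod_i f i (w i))%:E = \prod_i \int[P]_x (f i x)%:E)%E.
Proof.
move=> mf f0; rewrite ge0_integral_distribution//=; last 2 first.
- apply/measurable_EFinP; apply: measurable_prod => i _.
  exact: measurableT_comp (mf i) (measurable_ffun_eval i).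
- by move=> w; rewrite lee_fin prodr_ge0.
have bij : {on predT, bijective (@enum_val I predT)}.
  by apply: onW_bij; exact: enum_val_bij.
rewrite [RHS](reindex (@enum_val I predT))//= -integral_iid_tuple_prod//.
apply: eq_integral => t _ /=; rewrite (reindex (@enum_val I predT))//=.
by congr EFin; apply: eq_bigr => i _; rewrite ffunE enum_valK.
Qed.

End iid_product.

(** The exponential of a linear form is a product of functions of single coordinates, so
    independence multiplies the one-dimensional moments. The law of the linear form is never
    identified: its exponential moments suffice for Chernoff bounds. *)
Lemma iid_centered_normal_mgf (R : realType) (I : finType) (v : R) (a : I -> R) :
  0 < v ->
  (\int[iid (centered_normal v) I]_w (expR (\sum_i a i * w i))%:E =
   (expR ((\sum_i a i ^+ 2) * v / 2))%:E)%E.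
Proof.
move=> v0; under eq_integral do rewrite expR_sum.
rewrite (@integral_iid_prod _ _ _ _ _ (fun i x => expR (a i * x)))/=.
- transitivity (\prod_i (expR (a i ^+ 2 * v / 2))%:E)%E.
    by apply: eq_bigr => i _; exact: centered_normal_mgf.
  by rewrite prodEFin -expR_sum -!mulr_suml.
- by move=> i; apply: measurableT_comp => //.
- by move=> *; exact: expR_ge0.
Qed.

(** * Pairing noise with rank-one tensors *)

Section tensor_inner.
Context {R : realType}.

Definition tensor_inner n d (A B : tensor n d) : R := \sum_i A i * B i.

(** Distributivity: a product of [d] sums over coordinates expands into one sum over
    multi-indices. *)
Lemma tensor_inner_power n d (x y : @vec R n) :
  tensor_inner (tensor_power d x) (tensor_power d y) = inner x y ^+ d.
Proof.
rewrite /tensor_inner.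
under eq_bigr do rewrite !ffunE -big_split/=.
rewrite -(bigA_distr_bigA (fun (_ : 'I_d) j => x j * y j))/=.
by rewrite prodr_const card_ord.
Qed.

Lemma tensor_inner_add_spike n d lambda (y : @vec R n) p :
  tensor_inner (tensor_power d y) (add_spike lambda p) =
  lambda * inner p.1 y ^+ d + tensor_inner (tensor_power d y) p.2.
Proof.
rewrite -tensor_inner_power /tensor_inner mulr_sumr -big_split/=.
by apply: eq_bigr => i _; rewrite !ffunE; ring.
Qed.

Lemma tensor_inner_symmetrize n d (x : @vec R n) (W : tensor n d) :
  tensor_inner (tensor_power d x) (symmetrize W) =
  tensor_inner (tensor_power d x) W.
Proof.
rewrite /tensor_inner.
under eq_bigr do rewrite [symmetrize _ _]ffunE mulrCA mulr_sumr.
rewrite -mulr_sumr exchange_big/=.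
rewrite (eq_bigr (fun=> \sum_i tensor_power d x i * W i)) => [|s _]; last first.
  (* Permuting the axes is a bijection of multi-indices that fixes the entries of
     [tensor_power d x], so each of the [d!] summands equals the unsymmetrized pairing. *)
  pose act (t : 'S_d) (i : {ffun 'I_d -> 'I_n}) := [ffun k => i (t k)].
  rewrite [RHS](reindex (act s))/=; last first.
    by apply: onW_bij; exists (act s^-1%g) => i; apply/ffunP => k;
      rewrite !ffunE ?permK ?permKV.
  apply: eq_bigr => i _; congr (_ * _); rewrite !ffunE.
  rewrite (reindex_inj (@perm_inj _ s))/=.
  by apply: eq_bigr => k _; rewrite ffunE.
by rewrite sumr_const card_Sn -[X in _ * X]mulr_natl mulKf//.
Qed.

Lemma measurable_tensor_inner n d (A : tensor n d) :
  measurable_fun setT (tensor_inner A).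
Proof.
apply: measurable_sum => i; apply: measurable_realfun.measurable_funM => //.
exact: measurable_ffun_eval.
Qed.

Lemma measurable_inner n d' (S : measurableType d') (f g : S -> @vec R n) :
  measurable_fun setT f -> measurable_fun setT g ->
  measurable_fun setT (fun s => inner (f s) (g s)).
Proof.
move=> mf mg; apply: measurable_sum => i.
by apply: measurable_realfun.measurable_funM;
  apply: (measurableT_comp (measurable_ffun_eval i)).
Qed.

Lemma measurable_unit_vector n : measurable [set x : @vec R n | unit_vector x].
Proof.
have mi : measurable_fun setT (fun x : @vec R n => inner x x).
  by apply: measurable_inner; exact: measurable_id.
rewrite -[X in measurable X]setTI; exact: (mi measurableT [set 1]).
Qed.

(** For unit vectors the squared norms of [x + y] and [x - y] are [2 + 2<x,y>] and [2 - 2<x,y>];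
    their nonnegativity gives the two bounds. *)
Lemma cauchy_schwarz_unit n (x y : @vec R n) :
  unit_vector x -> unit_vector y -> `|inner x y| <= 1.
Proof.
move=> ux uy; have sq (c : R) : 0 <= \sum_i (x i + c * y i) ^+ 2.
  by apply: sumr_ge0 => i _; exact: sqr_ge0.
have E c : c ^+ 2 = 1 -> \sum_i (x i + c * y i) ^+ 2 = 2 + 2 * (c * inner x y).
  move=> c1; have -> : 2 + 2 * (c * inner x y) =
      inner x x + c ^+ 2 * inner y y + 2 * (c * inner x y).
    by rewrite ux uy c1; ring.
  rewrite /inner !mulr_sumr -!big_split/=; apply: eq_bigr => i _; ring.
have := sq 1; have := sq (-1); rewrite !E ?sqrrN ?expr1n// => h1 h2.
by rewrite ler_norml; apply/andP; split; lra.
Qed.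

(** The coefficients [a * x^{⊗d}] have squared norm [a^2 <x,x>^d = a^2], and the entry variance
    [2/n], halved, gives [1/n]. *)
Lemma WT_mgf n d (x : @vec R n) (a : R) : (0 < n)%N -> unit_vector x ->
  (\int[WT n d]_W (expR (a * tensor_inner (tensor_power d x) W))%:E =
   (expR (a ^+ 2 / n%:R))%:E)%E.
Proof.
move=> n0 ux; rewrite ge0_integral_distribution//=.
- under eq_integral => W _.
    rewrite tensor_inner_symmetrize /tensor_inner mulr_sumr.
    under eq_bigr do rewrite mulrA.
    over.
  rewrite (iid_centered_normal_mgf (fun i => a * tensor_power d x i)); last first.
    by rewrite divr_gt0// ltr0n.
  have -> : \sum_i (a * tensor_power d x i) ^+ 2 = a ^+ 2.
    under eq_bigr do rewrite exprMn expr2.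
    rewrite -mulr_sumr (_ : \sum_i _ = 1) ?mulr1//.
    rewrite -[RHS](expr1n R d) -[in RHS]ux -tensor_inner_power.
    by apply: eq_bigr => i _; rewrite expr2.
  by congr (expR _)%:E; field; rewrite pnatr_eq0 -lt0n.
- apply/measurable_EFinP; apply: measurableT_comp => //.
  apply: measurable_realfun.measurable_funM => //.
  exact: measurable_tensor_inner.
Qed.

(** The sign [c] covers both tails: [1] for false alarms, [-1] for noise that hides the true
    spike. *)
Lemma WT_tail n d (x : @vec R n) (c u : R) : (0 < n)%N -> unit_vector x ->
    c ^+ 2 = 1 -> 0 < u ->
  (WT n d [set W | (u <= c * tensor_inner (tensor_power d x) W)%R]
   <= (expR (- (n%:R * u ^+ 2 / 4)))%:E)%E.
Proof.
move=> n0 ux c1 u0.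
have mY : measurable_fun setT
    (fun W => c * tensor_inner (tensor_power d x) W).
  apply: measurable_realfun.measurable_funM => //.
  exact: measurable_tensor_inner.
pose Y : {RV (WT n d) >-> R} :=
  HB.pack (fun W => c * tensor_inner (tensor_power d x) W)
    (isMeasurableFun.Build _ _ _ _ _ mY).
(* The Chernoff exponent [r^2 / n - r u] is minimal at [r = n u / 2], with value [- n u^2 / 4]. *)
have r0 : 0 < n%:R * u / 2 by rewrite divr_gt0// mulr_gt0// ltr0n.
apply: (le_trans (chernoff Y u r0)).
rewrite /mmt_gen_fun unlock.
under eq_integral do rewrite /= mulrC mulrA.
rewrite WT_mgf// -EFinM -expRD lee_fin ler_expR exprMn c1 mulr1.
by rewrite le_eqVlt; apply/orP; left; apply/eqP; field; rewrite pnatr_eq0 -lt0n.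
Qed.

End tensor_inner.

(** * Measurability and integration on countable sets *)

Section countable_integral.
Context d (T : measurableType d) (R : realType).
Hypothesis m1 : forall x : T, measurable [set x].

(** A preimage is a subset of the countable set [D], together with the whole complement of [D] when
    it contains the value [c]. *)
Lemma measurable_fun_off_countable d' (S : measurableType d') (D : set T)
    (f : T -> S) (c : S) :
  countable D -> (forall x, ~ D x -> f x = c) -> measurable_fun setT f.
Proof.
move=> cD fc _ B mB; rewrite setTI.
have mDB : measurable (D `&` f @^-1` B).
  by apply: countable_measurable => //; apply: sub_countable cD;
    apply: subset_card_le => x [].
have [Bc|Bc] := pselect (B c).
  rewrite (_ : _ @^-1` _ = (D `&` f @^-1` B) `|` ~` D).
    apply: measurableU => //; apply: measurableC.
    exact: countable_measurable.
  apply/seteqP; split => x /=.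
    by have [Dx|nDx] := pselect (D x); [left|right].
  by move=> [[]//|/fc ->].
rewrite (_ : _ @^-1` _ = D `&` f @^-1` B)//.
apply/seteqP; split => x /=; last by case.
by have [Dx|/fc ->//] := pselect (D x).
Qed.

Lemma ge0_integral_countable (P : {measure set T -> \bar R}) (D : set T)
    (f : T -> \bar R) :
  countable D -> measurable_fun D f -> (forall x, 0 <= f x)%E ->
  (\int[P]_(x in D) f x = \esum_(x in D) (f x * P [set x]))%E.
Proof.
move=> /[dup] cD /countable_injP[g ginj] mf f0.
(* The fibres of an injection into the naturals are empty or singletons, which reduces the claim to
   countable additivity. *)
pose F k := D `&` g @^-1` [set k].
have cF k : F k = set0 \/ exists x, F k = [set x].
  have [->|/set0P[x [Dx gx]]] := eqVneq (F k) set0; [by left|right].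
  exists x; apply/seteqP; split => y /=; last by move=> ->.
  by move=> [Dy gy]; apply: ginj; rewrite ?inE// gx gy.
have UF : \bigcup_k F k = D.
  by apply/seteqP; split => [x [k _ []//]|x Dx]; exists (g x).
have tF : trivIset setT F by exact: trivIset_preimage1_in.
rewrite -UF ge0_integral_bigcup//; last 2 first.
- by move=> k; have [->//|[x ->]] := cF k.
- by rewrite UF.
rewrite esum_bigcupT//; last by move=> x; rewrite mule_ge0.
rewrite -nneseries_esumT; last first.
  by move=> k; apply: esum_ge0 => x _; rewrite mule_ge0.
apply: eq_eseriesr => k _; have [->|[x ->]] := cF k.
  by rewrite integral_set0 esum_set0.
rewrite esum_set1 ?mule_ge0//.
rewrite (eq_integral (cst (f x))) ?integral_cst// => y.
by rewrite inE/= => ->.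
Qed.

End countable_integral.

(** * Heavy atoms and the typical set of a discrete prior *)

Section typical_set.
Context {R : realType} (n : nat) (P : probability (@vec R n) R).

Lemma measurable_vec1 (x : @vec R n) : measurable [set x].
Proof.
rewrite (_ : [set x] =
    \bigcap_(i in [set: 'I_n]) ((fun y : @vec R n => y i) @^-1` [set x i])).
  apply: fin_bigcap_measurable => // i _.
  by rewrite -[X in measurable X]setTI; apply: measurable_ffun_eval.
apply/seteqP; split => [y /= -> //|y /= xy].
by apply/ffunP => i; exact: xy.
Qed.

Arguments measurable_vec1 : clear implicits.

Lemma measurable_countable_vec (A : set (@vec R n)) : countable A -> measurable A.
Proof.
by move=> cA; apply: countable_measurable cA; exact: measurable_vec1.
Qed.

Lemma massE x : (mass P x)%:E = P [set x].
Proof. by rewrite fineK// fin_num_measure//; exact: measurable_vec1. Qed.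

Lemma mass_ge0 x : 0 <= mass P x.
Proof. by rewrite -lee_fin massE. Qed.

Lemma mass_le1 x : mass P x <= 1.
Proof.
by rewrite -lee_fin massE probability_le1//; exact: measurable_vec1.
Qed.

Lemma surprisal_ge0 x : 0 <= surprisal P x.
Proof. by rewrite oppr_ge0 ln_le0// mass_le1. Qed.

Lemma sum_mass_le1 (r : seq (@vec R n)) : uniq r -> \sum_(x <- r) mass P x <= 1.
Proof.
move=> ur; rewrite -lee_fin -sumEFin.
under eq_bigr do rewrite massE.
have pr : perm_eq (fset_set [set` r]) r.
  apply: uniq_perm => // x; rewrite in_fset_set; last exact: finite_seq.
  by apply/idP/idP; rewrite inE.
rewrite -(perm_big _ pr)/=.
rewrite -measure_fbigsetU; last 2 first.
- by move=> x _; exact: measurable_vec1.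
- by move=> x y _ _ [z [/= <- <-]].
rewrite probability_le1//.
by apply: bigsetU_measurable => x _; exact: measurable_vec1.
Qed.

(** Total mass one leaves room for at most [1 / c] points of mass [c]. They are listed in a
    sequence, which the test and the estimator can scan. *)
Lemma finite_heavy_atoms (c : R) : 0 < c ->
  exists2 r : seq (@vec R n), (uniq r) /\ ((size r)%:R * c <= 1) &
    forall x, (x \in r) = (c <= mass P x).
Proof.
move=> c0; have bound (r : seq (@vec R n)) : uniq r ->
    (forall x, x \in r -> c <= mass P x) -> (size r)%:R * c <= 1.
  move=> ur cr; apply: le_trans (sum_mass_le1 ur).
  rewrite (_ : _ * c = \sum_(x <- r) c); last first.
    by rewrite big_const_seq count_predT iter_addr_0 mulr_natl.
  rewrite big_seq [leRHS]big_seq.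
  exact: ler_sum.
have fin : finite_set [set x | c <= mass P x].
  (* An infinite set would contain more than [1 / c] heavy points, against [bound]. *)
  apply: contrapT => /(@infinite_set_fset _ _ (Num.truncn c^-1).+1)[B Bc].
  apply/negP; rewrite -ltnNge -(ltr_nat R).
  have : (#|` B|)%:R * c <= 1
    by apply: bound => [|x xB]; [exact: fset_uniq|exact: Bc].
  rewrite -ler_pdivlMr// mul1r => /le_lt_trans; apply.
  exact: truncnS_gt.
exists (fset_set [set x | c <= mass P x]); first split; first exact: fset_uniq.
  apply: bound; first exact: fset_uniq.
  by move=> x; rewrite in_fset_set// inE.
by move=> x; rewrite in_fset_set//; apply/idP/idP; rewrite inE.
Qed.

(** An atom outside [A] would push the probability of [A] with [x] added above 1. Almost sure
    properties of the prior thus hold at every atom. *)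
Lemma full_set_atom (A : set (@vec R n)) (x : @vec R n) :
  measurable A -> P A = 1%E -> 0 < mass P x -> A x.
Proof.
move=> mA PA x0; apply: contrapT => nAx.
have : P (A `|` [set x]) = (P A + P [set x])%E.
  rewrite measureU//; first exact: measurable_vec1.
  by apply/seteqP; split => // y [/= Ay yx]; rewrite yx in Ay.
rewrite PA -massE => E.
have : (P (A `|` [set x]) <= 1)%E.
  by apply: probability_le1; apply: measurableU => //; exact: measurable_vec1.
by rewrite E -EFinD lee_fin gerDl leNgt x0.
Qed.

Hypothesis discreteP : exists2 S : set (@vec R n), countable S & P S = 1%E.

Lemma countable_atoms : countable (atoms P).
Proof.
have [S cS PS] := discreteP.
apply: sub_countable (cS); apply: subset_card_le => x.
by apply: full_set_atom PS; exact: measurable_countable_vec.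
Qed.

(** The non-atoms lie in the complement of the countable carrier, which is null, or form a countable
    set of null points. *)
Lemma probability_atoms : P (~` atoms P) = 0%E.
Proof.
have [S cS PS] := discreteP.
have mS : measurable S by exact: measurable_countable_vec.
have mA : measurable (atoms P).
  by apply: measurable_countable_vec; exact: countable_atoms.
have cD : countable (S `\` atoms P).
  by apply: sub_countable cS; apply: subset_card_le => x [].
have mD : measurable (S `\` atoms P) by exact: measurableD.
apply: (@subset_measure0 _ _ _ P _ (~` S `|` (S `\` atoms P))).
- exact: measurableC.
- by apply: measurableU => //; exact: measurableC.
- by move=> x nAx; have [Sx|] := pselect (S x); [right|left].
have PSC : P (~` S) = 0%E by rewrite probability_setC// PS subee.
apply: null_set_setU => //; first exact: measurableC.
rewrite -[LHS]mul1e -(integral_cst P mD).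
rewrite (ge0_integral_countable measurable_vec1)//.
apply: esum1 => x [_ /= nAx]; rewrite -massE mul1e; congr EFin.
by apply/eqP; rewrite eq_le mass_ge0 andbT leNgt; exact/negP.
Qed.

Lemma measurable_surprisal : measurable_fun setT (surprisal P).
Proof.
apply: (measurable_fun_off_countable measurable_vec1 countable_atoms
  (c := 0 : R)).
move=> x /negP; rewrite -leNgt => x0.
by rewrite /surprisal ln0// oppr0.
Qed.

(** Off the atoms [ln 0 = 0] makes the surprisal vanish, so the integral restricts to the countable
    set of atoms and becomes a sum. *)
Lemma expectation_surprisal : ('E_P[surprisal P] = renyi_entropy 1 P)%E.
Proof.
rewrite unlock /renyi_entropy eqxx.
have mA : measurable (atoms P).
  by apply: measurable_countable_vec; exact: countable_atoms.
transitivity (\int[P]_(x in atoms P) (surprisal P x)%:E)%E.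
  rewrite [RHS]integral_mkcond; apply: eq_integral => x _.
  rewrite patchE; case: ifPn => //; rewrite notin_setE/= => /negP.
  by rewrite -leNgt => x0; rewrite /surprisal ln0// oppr0.
rewrite (ge0_integral_countable measurable_vec1).
- apply: eq_esum => x _.
  transitivity ((surprisal P x)%:E * (mass P x)%:E)%E; first by rewrite massE.
  by rewrite -EFinM /surprisal mulNr mulrC.
- exact: countable_atoms.
- apply/measurable_EFinP; apply: measurable_funTS; exact: measurable_surprisal.
- by move=> x; rewrite lee_fin surprisal_ge0.
Qed.

(** An atom lighter than [e^{-a}] has surprisal above [a], while the mean surprisal is at most [b];
    Chebyshev bounds a deviation of [a - b]. *)
Lemma typical_set_prob (a b : R) : b < a -> (renyi_entropy 1 P <= b%:E)%E ->
  (P (~` [set x | expR (- a) <= mass P x]%R) <=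
   ((a - b) ^- 2)%:E * varentropy P)%E.
Proof.
move=> ab Hb.
have mf := measurable_surprisal.
pose Y : {RV P >-> R} :=
  HB.pack (surprisal P) (isMeasurableFun.Build _ _ _ _ _ mf).
have ab0 : 0 < a - b by rewrite subr_gt0.
apply: le_trans (chebyshev Y ab0).
have mB : measurable [set x | a - b <= `|Y x - fine ('E_P[Y])|]%R.
  rewrite -[X in measurable X]setTI.
  apply: measurable_fun_le => //.
  apply: measurableT_comp => //.
  exact: measurable_realfun.measurable_funB.
have mA : measurable (atoms P).
  by apply: measurable_countable_vec; exact: countable_atoms.
(* Non-atoms are light but have surprisal 0 by convention, so they may escape the Chebyshev event;
   being null, they are added to it. *)
rewrite -[leRHS](measureU0 mB (measurableC mA) probability_atoms).
apply: le_measure; rewrite ?inE.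
- apply: measurableC; rewrite -[X in measurable X]setTI.
  have [r [ur _] rE] := finite_heavy_atoms (expR_gt0 (- a)).
  rewrite setTI (_ : [set _ | _] = [set` r]).
    apply: measurable_countable_vec; apply: finite_set_countable.
    exact: finite_seq.
  by apply/seteqP; split => x /=; rewrite rE.
- by apply: measurableU => //; exact: measurableC.
- move=> x /= /negP; rewrite -ltNge => xa.
  have [x0|] := ltP 0 (mass P x); last by rewrite leNgt => /negP; right.
  left; apply: le_trans (ler_norm _).
  have E0 : (0 <= 'E_P[Y])%E by apply: expectation_ge0 => y; exact: surprisal_ge0.
  have Eb : fine ('E_P[Y]) <= b.
    have EYb : ('E_P[Y] <= b%:E)%E by rewrite expectation_surprisal.
    rewrite -lee_fin fineK// ge0_fin_numE// (le_lt_trans EYb)//.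
    by rewrite ltry.
  apply: lerB => //; rewrite /Y/= /surprisal lerNr.
  by rewrite ltW// -[- a]expRK ltr_ln ?posrE ?expR_gt0.
Qed.

End typical_set.

(** * Scanning a list of candidate spikes *)

Section scan.

Lemma measurable_holds d (T : measurableType d) (p : T -> bool) :
  measurable_fun setT p -> measurable [set x | p x].
Proof.
by move=> mp; rewrite -[X in measurable X]setTI; apply: (mp _ [set true]).
Qed.

Context {R : realType} (n d : nat) (r : seq (@vec R n)).

Definition detect (t : R) (T : tensor n d) : bool :=
  has (fun y => t <= tensor_inner (tensor_power d y) T) r.

(** When no candidate passes the threshold, [find] returns the size of [r] and [nth] falls back on
    [x0]. *)
Definition estimate (x0 : @vec R n) (t : R) (T : tensor n d) : vec n :=
  nth x0 r (find (fun y => t <= tensor_inner (tensor_power d y) T) r).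

Lemma measurable_score (t : R) (y : @vec R n) :
  measurable_fun setT (fun T : tensor n d =>
    t <= tensor_inner (tensor_power d y) T).
Proof.
apply: measurable_fun_ler => //; exact: measurable_tensor_inner.
Qed.

Lemma measurable_detect (t : R) : measurable_fun setT (detect t).
Proof.
rewrite /detect; elim: r => [|y s IHs]/=; first exact: measurable_cst.
apply: measurable_or => //; exact: measurable_score.
Qed.

Lemma measurable_estimate (x0 : @vec R n) (t : R) :
  measurable_fun setT (estimate x0 t).
Proof.
rewrite /estimate; elim: r => [|y s IHs]/=; first exact: measurable_cst.
rewrite [X in measurable_fun _ X](_ : _ = fun T : tensor n d =>
  if t <= tensor_inner (tensor_power d y) T then y else nth x0 s
    (find (fun y => t <= tensor_inner (tensor_power d y) T) s)); last first.
  by apply/funext => T; case: ifP.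
by apply: measurable_fun_ifT => //; exact: measurable_score.
Qed.

End scan.

(** * False alarms under pure noise *)

Section union_bound.
Context {R : realType} (n d : nat).

Lemma WT_detect_le (r : seq (@vec R n)) (u : R) : (0 < n)%N -> 0 < u ->
    {in r, forall y, unit_vector y} ->
  (WT n d [set W | detect r u W]
   <= ((size r)%:R * expR (- (n%:R * u ^+ 2 / 4)))%:E)%E.
Proof.
move=> n0 u0; elim: r => [|y s IHs] ur.
  by rewrite mul0r (_ : [set _ | _] = set0) ?measure0//; apply/seteqP; split.
have mS : measurable [set W : tensor n d |
    u <= tensor_inner (tensor_power d y) W].
  by apply: measurable_holds; exact: measurable_score.
have mH : measurable [set W : tensor n d | detect s u W].
  by apply: measurable_holds; exact: measurable_detect.
rewrite (_ : [set _ | _] = [set W | u <= tensor_inner (tensor_power d y) W]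
    `|` [set W | detect s u W]); last first.
  by apply/seteqP; split => W /=; [move/orP|move=> ?; apply/orP].
apply: (le_trans (measureU2 _ mS mH)).
rewrite [size _]/= -natr1 [X in (X * _)%R]addrC mulrDl mul1r EFinD leeD//.
  have uy : unit_vector y by apply: ur; rewrite mem_head.
  have := @WT_tail _ n d y 1 u n0 uy (expr1n _ _) u0.
  by under eq_set do rewrite mul1r.
by apply: IHs => z zs; apply: ur; rewrite in_cons zs orbT.
Qed.

End union_bound.

(** * Marginals and conditioning in a product law *)

Section product_bounds.
Context d1 d2 (T1 : measurableType d1) (T2 : measurableType d2) (R : realType).
Variables (P1 : probability T1 R) (P2 : probability T2 R).

Lemma product_probability_fst (A : set T1) : measurable A ->
  (P1 \x P2)%E [set p | A p.1] = P1 A.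
Proof.
move=> mA; rewrite (_ : [set p | A p.1] = A `*` setT); last first.
  by apply/seteqP; split => p //= [].
by rewrite product_measure1E// [X in (_ * X)%E]probability_setT mule1.
Qed.

Lemma product_probability_snd (B : set T2) : measurable B ->
  (P1 \x P2)%E [set p | B p.2] = P2 B.
Proof.
move=> mB; rewrite (_ : [set p | B p.2] = setT `*` B); last first.
  by apply/seteqP; split => p //= [].
by rewrite product_measure1E// [X in (X * _)%E]probability_setT mul1e.
Qed.

Lemma product_probability_le (C : set (T1 * T2)) (b : R) : measurable C ->
  (forall x, P2 (xsection C x) <= b%:E)%E -> ((P1 \x P2)%E C <= b%:E)%E.
Proof.
move=> mC Cb; apply: (@le_trans _ _ (\int[P1]_x (cst b%:E x))%E).
  by apply: ge0_le_integral => //=; exact: measurable_fun_xsection.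
by rewrite integral_cst// [X in (_ * X)%E]probability_setT mule1.
Qed.

End product_bounds.

(** * Detection and overlap in a fixed dimension *)

Section fixed_dimension.
Context {R : realType} (n d : nat) (X : prior_family R).
Variables (r : seq (@vec R n)) (lambda t' t : R).
Hypotheses (n0 : (0 < n)%N) (unitX : X n [set x | unit_vector x] = 1%E).
Hypothesis unitr : {in r, forall y, unit_vector y}.
Hypotheses (t'0 : 0 < t') (t't : t' < t) (tlambda : t < lambda).

Definition atypical : set (@vec R n * @tensor R n d) :=
  [set p | (~` [set` r]) p.1].

(** The level is [t'] and not the test level [t]: the gap [t - t'] is what the overlap gains. *)
Definition false_alarm : set (@vec R n * @tensor R n d) :=
  [set p | [set W | detect r t' W] p.2].

(** Membership in [r] makes the spike a unit vector, and the factor [-1] matches the sign [c] of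
    [WT_tail]. *)
Definition missed_spike : set (@vec R n * @tensor R n d) :=
  [set p | p.1 \in r /\
    lambda - t <= -1 * tensor_inner (tensor_power d p.1) p.2].

Definition bad : set (@vec R n * @tensor R n d) :=
  atypical `|` (false_alarm `|` missed_spike).

Lemma measurable_mem_seq (s : seq (@vec R n)) : measurable [set` s].
Proof.
apply: measurable_countable_vec; apply: finite_set_countable.
exact: finite_seq.
Qed.

Lemma measurable_atypical : measurable atypical.
Proof.
rewrite -[X in measurable X]setTI; apply: measurable_fst => //.
by apply: measurableC; exact: measurable_mem_seq.
Qed.

Lemma measurable_false_alarm : measurable false_alarm.
Proof.
rewrite -[X in measurable X]setTI; apply: measurable_snd => //.
by apply: measurable_holds; exact: measurable_detect.
Qed.

Lemma measurable_missed_spike : measurable missed_spike.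
Proof.
have mr : measurable (~` atypical).
  by apply: measurableC; exact: measurable_atypical.
rewrite (_ : missed_spike = ~` atypical `&` [set p |
    lambda - t <= -1 * tensor_inner (tensor_power d p.1) p.2]); last first.
  apply/seteqP; split => p [pr pl]; split => //.
  exact: contrapT.
apply: measurable_fun_le => //; apply: measurable_realfun.measurable_funM => //.
apply: measurable_funTS; apply: measurable_sum => i.
apply: measurable_realfun.measurable_funM.
  under eq_fun do rewrite ffunE.
  apply: measurable_prod => k _.
  exact: (measurableT_comp (measurable_ffun_eval _) measurable_fst).
exact: (measurableT_comp (measurable_ffun_eval i) measurable_snd).
Qed.

Lemma measurable_bad : measurable bad.
Proof.
apply: measurableU; first exact: measurable_atypical.
apply: measurableU; first exact: measurable_false_alarm.
exact: measurable_missed_spike.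
Qed.

Lemma bad_prob :
  (spike_noise d X n bad <= X n (~` [set` r]) +
    (((size r)%:R * expR (- (n%:R * t' ^+ 2 / 4)))%:E +
     (expR (- (n%:R * (lambda - t) ^+ 2 / 4)))%:E))%E.
Proof.
have mU : measurable (false_alarm `|` missed_spike).
  apply: measurableU; first exact: measurable_false_alarm.
  exact: measurable_missed_spike.
apply: (le_trans (measureU2 _ measurable_atypical mU)).
apply: leeD.
  have mC : measurable (~` [set` r]).
    by apply: measurableC; exact: measurable_mem_seq.
  by rewrite le_eqVlt; apply/orP; left; apply/eqP; exact: product_probability_fst.
apply: (le_trans (measureU2 _ measurable_false_alarm measurable_missed_spike)).
apply: leeD.
  have mD : measurable [set W : tensor n d | detect r t' W].
    by apply: measurable_holds; exact: measurable_detect.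
  apply: le_trans (@WT_detect_le _ n d r t' n0 t'0 unitr).
  by rewrite le_eqVlt; apply/orP; left; apply/eqP; exact: product_probability_snd.
(* Conditionally on the spike a single Gaussian tail suffices; a union bound
   over [r] would require [lambda - t] to be large. *)
apply: product_probability_le; first exact: measurable_missed_spike.
move=> x; have [xr|xr] := boolP (x \in r).
  have lt0 : 0 < lambda - t by rewrite subr_gt0.
  have s1 : (-1) ^+ 2 = 1 :> R by rewrite sqrrN expr1n.
  apply: le_trans (@WT_tail _ n d x (-1) (lambda - t) n0 (unitr xr) s1 lt0).
  rewrite (_ : xsection _ _ = [set W |
    (lambda - t <= -1 * tensor_inner (tensor_power d x) W)%R])//.
  by apply/seteqP; split => W; rewrite /xsection/= inE/= => // -[].
rewrite (_ : xsection _ _ = set0) ?measure0 ?lee_fin ?expR_ge0//.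
apply/seteqP; split => // W; rewrite /xsection/= inE/= => -[].
by rewrite (negbTE xr).
Qed.

(** The spike is itself a listed candidate, and its signal [lambda] loses less than [lambda - t] to
    the noise. *)
Lemma good_detect p : ~ bad p -> detect r t (add_spike lambda p).
Proof.
move=> /not_orP[/contrapT /= pr /not_orP[_ /not_andP[//|/negP]]].
rewrite -ltNge => Wp; apply/hasP; exists p.1 => //.
rewrite tensor_inner_add_spike [inner _ _](unitr pr) expr1n mulr1.
by move: Wp; lra.
Qed.

Lemma good_overlap x0 p : ~ bad p ->
  (t - t') / lambda <= overlap lambda (estimate r x0 t) p.
Proof.
move=> good; have := good_detect good => det.
have := nth_find x0 det; have := mem_nth x0 (etrans (esym (has_find _ _)) det).
rewrite -/(estimate r x0 t (add_spike lambda p)) => er.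
(* The absence of false alarms holds for the whole list at once, hence for the returned atom,
   although that atom depends on the noise. *)
move: good => /not_orP[_ /not_orP[/negP/hasPn/(_ _ er) + _]].
rewrite tensor_inner_add_spike /overlap -ltNge => noise score.
have l0 : 0 < lambda by apply: lt_trans (lt_trans t'0 t't) tlambda.
rewrite ler_pdivrMr// mulrC.
by move: score; rewrite -lerBlDr; apply: le_trans; rewrite lerB// ltW.
Qed.

Let Q := spike_noise d X n.

Lemma detect_success (test : {mfun tensor n d >-> bool}) :
    test =1 detect r t ->
  (1 - (Q bad + ((size r)%:R * expR (- (n%:R * t' ^+ 2 / 4)))%:E)
    <= success_probability lambda X test)%E.
Proof.
move=> testE; set b := _ * expR _.
have b0 : 0 <= b by rewrite mulr_ge0 ?expR_ge0.
have Qfin : Q bad \is a fin_num.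
  by rewrite fin_num_measure//; exact: measurable_bad.
have mtest c : measurable [set T | test T = c].
  by rewrite -[X in measurable X]setTI; exact: (measurable_funPT test _ [set c]).
have spiked : (1 - Q bad <= spiked_WT d lambda X n [set T | test T = true])%E.
  rewrite -probability_setC; last exact: measurable_bad.
  apply: le_measure; rewrite ?inE.
  - by apply: measurableC; exact: measurable_bad.
  - rewrite -[X in measurable X]setTI.
    exact: (measurable_add_spike lambda measurableT (mtest true)).
  - by move=> p good /=; rewrite testE good_detect.
have null : (1 - b%:E <= WT n d [set T | test T = false])%E.
  have -> : [set T | test T = false] = ~` [set T | test T = true].
    by apply/seteqP; split => T /=; case: (test T).
  rewrite probability_setC//; apply: leeB => //.
  (* An alarm at level [t] is also one at the lower level [t'], where the union bound is
     available. *)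
  apply: le_trans (@WT_detect_le _ n d r t' n0 t'0 unitr).
  apply: le_measure; rewrite ?inE//.
    by apply: measurable_holds; exact: measurable_detect.
  move=> T /=; rewrite testE => /hasP[y yr ty]; apply/hasP; exists y => //.
  exact: le_trans (ltW t't) ty.
rewrite /success_probability.
(* The average of the two bounds is [1 - (Q bad + b) / 2]; the factor [1/2] is given away. *)
apply: (@le_trans _ _ (2^-1%:E * (1 - Q bad) + 2^-1%:E * (1 - b%:E))%E).
  rewrite -(fineK Qfin) -EFinD -!EFinB -!EFinM -EFinD lee_fin.
  have : 0 <= fine (Q bad) by exact: fine_ge0.
  by lra.
by apply: leeD; apply: lee_wpmul2l; rewrite // lee_fin invr_ge0.
Qed.

Lemma estimate_unit x0 (T : tensor n d) :
  unit_vector x0 -> unit_vector (estimate r x0 t T).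
Proof.
move=> ux0; rewrite /estimate; have [h|h] := boolP (has (fun y =>
    t <= tensor_inner (tensor_power d y) T) r).
  by apply: unitr; rewrite mem_nth// -has_find.
by rewrite (hasNfind h) nth_default.
Qed.

Lemma overlap_expectation x0 : unit_vector x0 ->
  (((t - t') / lambda)%:E - (1 + (t - t') / lambda)%:E * Q bad
   <= 'E_Q[overlap lambda (estimate r x0 t)])%E.
Proof.
move=> ux0; set k := (t - t') / lambda.
have mg : measurable (~` bad) by apply: measurableC; exact: measurable_bad.
have Qfin : Q bad \is a fin_num.
  by rewrite fin_num_measure//; exact: measurable_bad.
pose U := [set p : @vec R n * @tensor R n d | [set x | unit_vector x] p.1].
have mU : measurable U.
  rewrite -[X in measurable X]setTI; apply: measurable_fst => //.
  exact: measurable_unit_vector.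
have QU : Q U = 1%E.
  rewrite -unitX; apply: product_probability_fst.
  exact: measurable_unit_vector.
have QU0 : Q (~` U) = 0%E by rewrite probability_setC// QU subee.
have mest := @measurable_estimate R n d r x0 t.
have mov : measurable_fun setT (overlap lambda (estimate (d := d) r x0 t)).
  apply: measurable_realfun.measurable_funX.
  apply: measurable_inner; first exact: measurable_fst.
  exact: measurableT_comp mest (measurable_add_spike lambda).
have ov1 p : U p -> `|overlap lambda (estimate r x0 t) p| <= 1.
  move=> Up; rewrite /overlap normrX exprn_ile1//.
  by apply: cauchy_schwarz_unit => //; exact: estimate_unit.
rewrite unlock.
have k0 : 0 <= k.
  rewrite divr_ge0// ?subr_ge0 ltW//.
  exact: lt_trans (lt_trans t'0 t't) tlambda.
(* The overlap is only bounded for unit spikes, hence almost surely. *)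
have -> : (\int[Q]_p (overlap lambda (estimate r x0 t) p)%:E =
    \int[Q]_p (overlap lambda (estimate r x0 t) p * \1_U p)%:E)%E.
  apply: ae_eq_integral => //.
  - exact/measurable_EFinP.
  - by apply/measurable_EFinP; apply: measurable_realfun.measurable_funM.
  - exists (~` U); split; [exact: measurableC|exact: QU0|].
    move=> p /= /not_implyP[_ h] Up; apply: h.
    by rewrite indicE mem_set// mulr1.
have intc (c : R) : Q.-integrable setT (fun=> c%:E).
  exact: finite_measure_integrable_cst.
have intg : Q.-integrable setT (fun p => (\1_(~` bad) p)%:E).
  apply: measurable_bounded_integrable => //.
  - by rewrite ltey_eq fin_num_measure.
  - exists 1; split => // x x1 p _ /=; rewrite indicE.
    by rewrite (le_trans _ (ltW x1))//; case: (_ \in _); rewrite ?normr1 ?normr0.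
(* The minorant [(1 + k) 1_{good} - 1] is [k] outside [bad] and, on [bad], the least value [-1] that
   the overlap of unit vectors can take. *)
have -> : (k%:E - (1 + k)%:E * Q bad =
    \int[Q]_p ((1 + k)%:E * (\1_(~` bad) p)%:E - 1%:E))%E.
  rewrite integralB//; last exact: integrableZl.
  have -> : (\int[Q]__ 1%:E = 1)%E.
    by rewrite integral_cst// mul1e; exact: probability_setT.
  have I1 : (\int[Q]_p (\1_(~` bad) p)%:E = 1 - Q bad)%E.
    rewrite integral_indic// setIT; apply: probability_setC.
    exact: measurable_bad.
  rewrite integralZl// I1.
  rewrite -(fineK Qfin) -!EFinB; congr EFin; ring.
apply: le_integral => //.
- by apply: integrableB => //; exact: integrableZl.
- apply: measurable_bounded_integrable => //.
  + by rewrite ltey_eq fin_num_measure.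
  + exact: measurable_realfun.measurable_funM.
  + exists 1; split => // x x1 p _ /=; rewrite (le_trans _ (ltW x1))// indicE.
    have [Up|nUp] := pselect (U p).
      by rewrite mem_set// mulr1 ov1.
    by rewrite memNset// mulr0 normr0.
move=> p _; rewrite -EFinM -EFinB lee_fin !indicE.
have [bp|gp] := pselect (bad p).
  rewrite memNset; last by move=> /(_ bp).
  rewrite mulr0 sub0r; have [Up|nUp] := pselect (U p).
    by rewrite mem_set// mulr1; have := ov1 p Up; rewrite ler_norml => /andP[].
  by rewrite memNset// mulr0.
have pr : p.1 \in r by apply: contrapT => npr; apply: gp; left.
have Up : U p by exact: unitr.
rewrite !mem_set// !mulr1; have := good_overlap x0 gp.
by rewrite -/k; lra.
Qed.

End fixed_dimension.

(** * Limits as the dimension grows *)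

Section asymptotics.
Context {R : realType}.

Lemma cvg_expR_decay (c : R) : 0 < c ->
  (fun n => expR (- (n%:R * c))) @ \oo --> (0 : R).
Proof.
move=> c0; rewrite (_ : (fun n => _) = (fun n => expR (- c) ^+ n)).
  apply: cvg_expr; rewrite ger0_norm ?expR_ge0//.
  by rewrite -[ltRHS]expR0 ltr_expR oppr_lt0.
by apply/funext => n; rewrite -mulrN expRM_natl.
Qed.

Lemma limn_esup_lt_near (u : (\bar R)^nat) (l : \bar R) :
  (limn_esup u < l)%E -> \forall n \near \oo, (u n < l)%E.
Proof.
move=> /ereal_inf_lt[_ [V FV <-] Vl]; apply: filterS FV => n Vn.
by apply: le_lt_trans Vl; apply: ereal_sup_ubound; exists n.
Qed.

Lemma cvge_to0_lt_near (u : (\bar R)^nat) (e : R) : 0 < e ->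
  u @ \oo --> 0%E -> \forall n \near \oo, (u n < e%:E)%E.
Proof.
move=> e0 /fine_cvgP[ufin u0].
have une : \forall n \near \oo, fine (u n) < e by exact: cvgr_lt u0 e e0.
near=> n.
have un : u n \is a fin_num by near: n.
by rewrite -(fineK un) lte_fin; near: n.
Unshelve. all: by end_near.
Qed.

Lemma success_probability_le1 n d lambda (X : prior_family R)
  (test : {mfun tensor n d >-> bool}) :
  (success_probability lambda X test <= 1)%E.
Proof.
have mtest c : measurable [set T | test T = c].
  by rewrite -[X in measurable X]setTI; exact: (measurable_funPT test _ [set c]).
rewrite (_ : 1 = 2^-1%:E + 2^-1%:E)%E; last by rewrite -EFinD; congr EFin; lra.
by apply: leeD; rewrite -[leRHS]mule1; apply: lee_wpmul2l;
  rewrite ?lee_fin ?invr_ge0//; exact: probability_le1.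
Qed.

(** The fallback of the estimator. Comparing indices in [nat] gives a definition for every [n],
    including 0. *)
Definition first_axis n : @vec R n := [ffun i : 'I_n => (i == 0%N :> nat)%:R].

Lemma first_axis_unit n : (0 < n)%N -> unit_vector (first_axis n).
Proof.
case: n => // n _; rewrite /unit_vector /inner (bigD1 ord0)//= !ffunE eqxx mulr1.
rewrite big1 ?addr0// => i i0; rewrite ffunE.
by rewrite -val_eqE/= in i0; rewrite (negbTE i0) mulr0.
Qed.

End asymptotics.

(** * Choice of thresholds and passage to the limit *)

Theorem proposition4p2 (R : realType) (d : nat) (X : prior_family R)
    (s lambda : R)
    (hd : (2 <= d)%N)
    (hsphere : spherical_prior X)
    (hdiscrete : discrete_prior X)
    (hrenyi : exists2 delta : R, 0 < delta <= 1 &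
      (entropy_density (1 - delta) X < +oo)%E)
    (hvarentropy :
      (fun n => ((n%:R ^+ 2)^-1%:E * varentropy (X n))%E) @ \oo --> 0%E)
    (hs : entropy_density 1 X = s%:E)
    (hlambda0 : 0 <= lambda)
    (hlambda : 2 * Num.sqrt s < lambda) :
  strong_detection d lambda X /\ weak_recovery d lambda X.
Proof.
have q0 : 0 <= Num.sqrt s by exact: sqrtr_ge0.
(* An inequality avoids deriving [0 <= s] from the entropies, since the root of a negative real is
   0. *)
have qs : s <= Num.sqrt s ^+ 2.
  have [s0|s0] := leP 0 s; first by rewrite sqr_sqrtr.
  by rewrite (le_trans (ltW s0))// sqr_ge0.
(* [t'] is the midpoint of [2 sqrt s] and [lambda], [t] that of [t'] and [lambda], and
   [s + 2 eta = t'^2 / 4]. *)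
pose t' := Num.sqrt s + lambda / 2.
pose t := (t' + lambda) / 2.
pose eta := (t' ^+ 2 / 4 - s) / 2.
have t'q : 2 * Num.sqrt s < t' by rewrite /t'; lra.
have t'0 : 0 < t' by lra.
have t't : t' < t by rewrite /t /t'; lra.
have tl : t < lambda by rewrite /t /t'; lra.
have eta0 : 0 < eta.
  rewrite /eta divr_gt0// subr_gt0; apply: (le_lt_trans qs).
  rewrite ltr_pdivlMr// (_ : _ * 4 = (2 * Num.sqrt s) ^+ 2); last by ring.
  by rewrite ltr_pXn2r ?nnegrE// ?ltW// mulr_ge0.
(* [eta] is such that [n t'^2 / 4 = a n + n eta]. *)
pose a n : R := n%:R * (s + eta).
(* [b n] eventually bounds the entropy. The gap [a n - b n = n eta / 2] is linear in [n], so
   Chebyshev succeeds against a varentropy of order [o(n^2)]. *)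
pose b n : R := n%:R * (s + eta / 2).
pose heavy n := cid2 (finite_heavy_atoms (X n) (expR_gt0 (- a n))).
pose r n := s2val (heavy n).
have rE n x : (x \in r n) = (expR (- a n) <= mass (X n) x).
  by rewrite /r; case: (heavy n).
have rsize n : (size (r n))%:R * expR (- (n%:R * t' ^+ 2 / 4))
    <= expR (- (n%:R * eta)).
  have : (size (r n))%:R * expR (- a n) <= 1 by rewrite /r; case: (heavy n) => ? [].
  have -> : - (n%:R * t' ^+ 2 / 4) = - a n - n%:R * eta.
    by rewrite /a /eta; field.
  by rewrite expRD mulrA => h; rewrite ler_piMl ?expR_ge0.
have unitr n : (0 < n)%N -> {in r n, forall y, unit_vector y}.
  move=> n0 y; rewrite rE => cy.
  apply: (full_set_atom (@measurable_unit_vector R n) (hsphere n n0)).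
  exact: lt_le_trans (expR_gt0 _) cy.
(* One error bound for both conclusions: an atypical spike, false alarms counted twice (once inside
   [bad], once for the test under pure noise), and a missed spike. *)
pose gamma n : \bar R := (((n%:R * (eta / 2)) ^- 2)%:E * varentropy (X n) +
  (expR (- (n%:R * eta)) + expR (- (n%:R * eta)) +
   expR (- (n%:R * ((lambda - t) ^+ 2 / 4))))%:E)%E.
have gamma0 : gamma @ \oo --> 0%E.
  rewrite -[0%E]adde0; apply: cvgeD => //.
    rewrite (_ : (fun n => _) = (fun n => ((eta / 2) ^- 2)%:E *
        ((n%:R ^+ 2)^-1%:E * varentropy (X n))))%E; last first.
      by apply/funext => n; rewrite muleA -EFinM exprMn invfM mulrC.
    rewrite -[0%E](mule0 ((eta / 2) ^- 2)%:E).
    by apply: cvgeZl.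
  apply/fine_cvgP; split; first by apply: nearW.
  rewrite -[0]addr0; apply: cvgD; last first.
    by apply: cvg_expR_decay; rewrite divr_gt0// exprn_gt0// subr_gt0.
  by rewrite -[0]addr0; apply: cvgD; exact: cvg_expR_decay.
have entropy_near : \forall n \near \oo, (renyi_entropy 1 (X n) <= (b n)%:E)%E.
  have : (entropy_density 1 X < (s + eta / 2)%:E)%E.
    by rewrite hs lte_fin ltrDl divr_gt0.
  move=> /limn_esup_lt_near Hnear; near=> n.
  have n0 : (0 < n)%N by near: n; exact: nbhs_infty_gt.
  have /ltW : (n%:R^-1%:E * renyi_entropy 1 (X n) < (s + eta / 2)%:E)%E by near: n.
  have n0' : (0 : R) < n%:R by rewrite ltr0n.
  by rewrite muleC lee_pdivrMr// -EFinM mulrC.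
have bad_near : \forall n \near \oo, [/\ (0 < n)%N,
    (spike_noise d X n (bad (d := d) (r n) lambda t' t) <= gamma n)%E &
    (spike_noise d X n (bad (d := d) (r n) lambda t' t) +
     ((size (r n))%:R * expR (- (n%:R * t' ^+ 2 / 4)))%:E <= gamma n)%E].
  near=> n.
  have n0 : (0 < n)%N by near: n; exact: nbhs_infty_gt.
  have Hn : (renyi_entropy 1 (X n) <= (b n)%:E)%E by near: n.
  have nR : (0 : R) < n%:R by rewrite ltr0n.
  have ba : b n < a n by rewrite ltr_pM2l// ltrD2l ltr_pdivrMr//; lra.
  have typ : (X n (~` [set` r n]) <=
      ((n%:R * (eta / 2)) ^- 2)%:E * varentropy (X n))%E.
    have -> : [set` r n] = [set x | expR (- a n) <= mass (X n) x].
      by apply/seteqP; split => x /=; rewrite rE.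
    have -> : n%:R * (eta / 2) = a n - b n by rewrite /a /b; field.
    exact (typical_set_prob (hdiscrete n n0) ba Hn).
  have spike0 : expR (- (n%:R * (lambda - t) ^+ 2 / 4)) =
      expR (- (n%:R * ((lambda - t) ^+ 2 / 4))).
    by rewrite mulrA.
  have e0 := expR_ge0 (- (n%:R * eta)).
  have Qbad := @bad_prob _ n d X (r n) lambda t' t n0 (unitr n n0) t'0 tl.
  have rn := rsize n.
  split => //.
    apply: (le_trans Qbad); rewrite -EFinD spike0; apply: leeD => //.
    by rewrite lee_fin; lra.
  apply: (le_trans (leeD Qbad (lexx _))).
  rewrite -EFinD spike0 -addeA; apply: leeD => //.
  by rewrite -EFinD lee_fin; lra.
split.
  pose test n : {mfun tensor n d >-> bool} :=
    HB.pack (detect (d := d) (r n) t)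
      (isMeasurableFun.Build _ _ _ _ _ (measurable_detect (r n) t)).
  exists test.
  (* The success probability is squeezed between [1 - gamma n] and 1. *)
  apply: (@squeeze_cvge _ _ _ _ (fun n => 1 - gamma n)%E _ (cst 1%E)).
  - near=> n; rewrite success_probability_le1 andbT.
    have [n0 _ Qbad] : [/\ (0 < n)%N,
      (spike_noise d X n (bad (d := d) (r n) lambda t' t) <= gamma n)%E &
      (spike_noise d X n (bad (d := d) (r n) lambda t' t) +
       ((size (r n))%:R * expR (- (n%:R * t' ^+ 2 / 4)))%:E <= gamma n)%E].
      by near: n.
    apply: le_trans (leeB (lexx _) Qbad) _.
    by apply: detect_success => //; exact: unitr.
  - rewrite -[X in _ --> X]sube0; apply: cvgeB => //; exact: cvg_cst.
  - exact: cvg_cst.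
pose k : R := (t - t') / lambda.
have l0 : 0 < lambda by rewrite (lt_trans t'0)// (lt_trans t't).
have k0 : 0 < k by rewrite divr_gt0// subr_gt0.
(* Solves [(1 + k) e = k / 2]: once [gamma n < e], the bad event costs at most half of the overlap
   [k]. *)
pose e : R := k / 2 / (1 + k).
have k1 : 0 < 1 + k by rewrite addr_gt0.
have e0 : 0 < e by apply: divr_gt0 => //; apply: divr_gt0.
pose xhat n : {mfun tensor n d >-> @vec R n} :=
  HB.pack (estimate (d := d) (r n) (first_axis n) t)
    (isMeasurableFun.Build _ _ _ _ _ (measurable_estimate (r n) (first_axis n) t)).
exists xhat, (k / 2); split; first by rewrite divr_gt0.
  move=> n T n0; apply: estimate_unit; first exact: unitr.
  exact: first_axis_unit.
have gamma_e := cvge_to0_lt_near e0 gamma0.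
near=> n.
have [n0 Qbad _] : [/\ (0 < n)%N,
  (spike_noise d X n (bad (d := d) (r n) lambda t' t) <= gamma n)%E &
  (spike_noise d X n (bad (d := d) (r n) lambda t' t) +
   ((size (r n))%:R * expR (- (n%:R * t' ^+ 2 / 4)))%:E <= gamma n)%E].
  by near: n.
have ge : (gamma n < e%:E)%E by near: n.
have ov := overlap_expectation d (hsphere n n0) (unitr n n0) t'0 t't tl
  (first_axis_unit n0).
apply: le_trans ov.
rewrite -/k; apply: (@le_trans _ _ (k%:E - (1 + k)%:E * e%:E)%E).
  have ke : (1 + k) * e = k / 2 by rewrite /e; field; rewrite gt_eqF.
  by rewrite -EFinM ke -EFinB lee_fin; lra.
apply: leeB => //; apply: lee_wpmul2l; first by rewrite lee_fin ltW.
exact: le_trans Qbad (ltW ge).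
Unshelve. all: by end_near.
Qed.
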